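(* Let $d\ge 3$ be an integer, let $\mathbb{K}$ be a field whose characteristic does not divide $d!$ and which contains a primitive $d$-th root of unity $\omega$, and let $V$ be a nonzero finite-dimensional vector space over $\mathbb{K}$. Fix a $d$-cycle $\sigma\in S_d$. Let $i\in\{1,\dots,d-1\}$ and let $F\colon V\times\cdots\times V\to\mathbb{K}$ ($d$ factors) be a multilinear form with $$F\in\Big(\bigoplus_{\lambda\neq (d),\,(d-1,1)} W_\lambda(V,\mathbb{K})\Big)\oplus W^i_{(d-1,1)}(V,\mathbb{K}),$$ where $\lambda$ runs over the partitions of $d$ other than $(d)$ and $(d-1,1)$. Then the hyperdeterminant of $F$ vanishes: $\mathrm{Det}(F)=0$.
   Context: Let $C^d(V,\mathbb{K})=V^*\otimes\cdots\otimes V^*$ ($d$ factors) be the space of multilinear forms $F\colon V\times\cdots\times V\to\mathbb{K}$. The symmetric group $S_d$ acts on it by $(\tau F)(x_1,\dots,x_d)=F(x_{\tau(1)},\dots,x_{\tau(d)})$. Since the characteristic of $\mathbb{K}$ does not divide $d!$, the irreducible representations of $S_d$ over $\mathbb{K}$ are indexed by the partitions $\lambda$ of $d$ in the usual way; the representation attached to $\lambda$ is denoted $V_\lambda$. Here $V_{(d)}$ is the trivial representation, $V_{(1,\dots,1)}$ is the sign representation, and $V_{(d-1,1)}$ is the standard representation, i.e. the hyperplane $\{(x_1,\dots,x_d)\in\mathbb{K}^d : x_1+\cdots+x_d=0\}$ with $S_d$ permuting coordinates. $W_\lambda(V,\mathbb{K})$ denotes the $V_\lambda$-isotypic component of $C^d(V,\mathbb{K})$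 (the sum of all subrepresentations isomorphic to $V_\lambda$), so that $C^d(V,\mathbb{K})=\bigoplus_\lambda W_\lambda(V,\mathbb{K})$. For $k\in\{1,\dots,d-1\}$, with $\sigma$ the fixed $d$-cycle and $\omega$ the fixed primitive $d$-th root of unity, $$W^k_{(d-1,1)}(V,\mathbb{K})=\{F\in W_{(d-1,1)}(V,\mathbb{K}) : \sigma F=\omega^k F\}.$$ Hyperdeterminant: if $v_1,\dots,v_n$ is a basis of $V$, a form $F$ corresponds to the hypermatrix $a_{i_1\cdots i_d}=F(v_{i_1},\dots,v_{i_d})$ of size $n\times\cdots\times n$, and $\mathrm{Det}(F)$ is the hyperdeterminant (in the sense of Gelfand–Kapranov–Zelevinsky) of this hypermatrix, a homogeneous polynomial in the entries $a_{i_1\cdots i_d}$; its vanishing does not depend on the basis and is unchanged by extending the base field. Over an algebraically closed field, $\mathrm{Det}(F)=0$ if and only if there exist nonzero $v_1,\dots,v_d\in V$ such that for every $j\in\{1,\dots,d\}$ and every $w\in V$ one has $F(v_1,\dots,v_{j-1},w,v_{j+1},\dots,v_d)=0$. For a general field $\mathbb{K}$, $\mathrm{Det}(F)=0$ if and only if this holds for the extension of $F$ to $V\otimes_{\mathbb{K}}\overline{\mathbb{K}}$, where $\overline{\mathbb{K}}$ is an algebraic closure of $\mathbb{K}$. *)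

(* Defs.v *)
From HB Require Import structures.
From mathcomp Require Import all_boot all_order all_algebra all_fingroup.
From mathcomp Require Import all_field mxrepresentation.
From mathcomp Require Import mpoly.

Set Implicit Arguments.
Unset Strict Implicit.
Unset Printing Implicit Defensive.

Import Order.TTheory GRing.Theory Num.Theory.

Local Open Scope ring_scope.

Definition formfun (d : nat) (K : fieldType) (V : lmodType K) : Type :=
  {ffun 'I_d -> V} -> K.

(* (x_1, ..., x_{j-1}, w, x_{j+1}, ..., x_d) *)
Definition subst_arg (d : nat) (T : Type) (x : {ffun 'I_d -> T}) (j : 'I_d)
    (w : T) : {ffun 'I_d -> T} :=
  [ffun k => if k == j then w else x k].

Definition multilinear (d : nat) (K : fieldType) (V : lmodType K)
    (F : formfun d V) : Prop :=
  forall (x : {ffun 'I_d -> V}) (j : 'I_d),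
    scalar (fun w : V => F (subst_arg x j w)).

(* Products in 'S_d are read from left to right, (s * t) k = t (s k), so that
   perm_form (s * t) F = perm_form t (perm_form s F); this is the convention
   of mx_representation, which acts on row vectors from the right. *)
Definition perm_form (d : nat) (K : fieldType) (V : lmodType K)
    (tau : 'S_d) (F : formfun d V) : formfun d V :=
  fun x => F [ffun k => x (tau k)].

Definition subrep (d : nat) (K : fieldType) (V : lmodType K)
    (U : formfun d V -> Prop) : Prop :=
  [/\ forall F, U F -> multilinear F,
      U (fun=> 0),
      forall (a : K) F G, U F -> U G -> U (fun x => a * F x + G x)
    & forall (tau : 'S_d) F, U F -> U (perm_form tau F)].

Definition sum_of_subspaces (d : nat) (K : fieldType) (V : lmodType K)
    (P : (formfun d V -> Prop) -> Prop) : formfun d V -> Prop :=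
  fun F => exists (m : nat) (G : 'I_m -> formfun d V),
    (forall k, exists2 U, P U & U (G k)) /\ (forall x, F x = \sum_k G k x).

Definition is_partition (d : nat) (lam : seq nat) : Prop :=
  [/\ sorted geq lam, 0%N \notin lam & sumn lam = d].

(* The boxes of the Young diagram of lam are numbered 0, ..., d - 1 row after
   row; reshape_index and reshape_offset give the row and the column. *)
Definition row_group (d : nat) (lam : seq nat) : {set 'S_d} :=
  [set p : 'S_d |
    [forall k : 'I_d, reshape_index lam (p k) == reshape_index lam k]].

Definition col_group (d : nat) (lam : seq nat) : {set 'S_d} :=
  [set q : 'S_d |
    [forall k : 'I_d, reshape_offset lam (q k) == reshape_offset lam k]].

(* An element of the group algebra K[S_d] is a row vector of coordinates, g
   being the basis vector of index gring_index g. *)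
Definition young_symmetrizer (d : nat) (K : fieldType) (lam : seq nat) :
    'rV[K]_#|[set: 'S_d]%G| :=
  \sum_(p in row_group d lam) \sum_(q in col_group d lam)
    (-1) ^+ odd_perm q *: delta_mx 0 (gring_index [set: 'S_d]%G (q * p)%g).

(* V_lam = K[S_d] c_lam, with c_lam the Young symmetrizer.  Since q * p is the
   composite "first q, then p", c_lam is the usual sum of sgn(q) (p o q), and
   the representation of g on K[S_d] is h |-> h * g = g o h. *)
Definition irr_module (d : nat) (K : fieldType) (lam : seq nat) :
    'M[K]_#|[set: 'S_d]%G| :=
  cyclic_mx (regular_repr K [set: 'S_d]%G) (young_symmetrizer d K lam).

(* U is the image of an injective K[S_d]-linear map phi defined on V_lam; only
   the values of phi on V_lam matter. *)
Definition iso_irr_module (d : nat) (K : fieldType) (V : lmodType K)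
    (lam : seq nat) (U : formfun d V -> Prop) : Prop :=
  exists phi : 'rV[K]_#|[set: 'S_d]%G| -> formfun d V,
    [/\ forall x, scalar (fun u => phi u x),
        forall (g : 'S_d) u, (u <= irr_module d K lam)%MS ->
          phi (u *m regular_repr K [set: 'S_d]%G g) =1 perm_form g (phi u),
        forall u, (u <= irr_module d K lam)%MS -> phi u =1 (fun=> 0) -> u = 0
      & forall F, U F <->
          exists2 u, (u <= irr_module d K lam)%MS & F =1 phi u].

Definition isotypic (d : nat) (K : fieldType) (V : lmodType K)
    (lam : seq nat) : formfun d V -> Prop :=
  sum_of_subspaces (fun U => subrep U /\ iso_irr_module lam U).

Definition std_eigen (d : nat) (K : fieldType) (V : lmodType K)
    (sigma : 'S_d) (omega : K) (k : nat) : formfun d V -> Prop :=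
  fun F => isotypic [:: d.-1; 1%N] F /\
    (forall x, perm_form sigma F x = omega ^+ k * F x).

Definition is_full_cycle (d : nat) (sigma : 'S_d) : Prop :=
  porbits sigma = [set [set: 'I_d]].

Definition degenerate (d : nat) (K : fieldType) (V : lmodType K)
    (F : formfun d V) : Prop :=
  exists v : {ffun 'I_d -> V},
    (forall j, v j != 0) /\ (forall j w, F (subst_arg v j w) = 0).

Definition hypermatrix (d n : nat) (T : Type) : Type :=
  {ffun {ffun 'I_d -> 'I_n} -> T}.

Definition form_of_hypermatrix (d n : nat) (K : fieldType)
    (A : hypermatrix d n K) : formfun d 'rV[K]_n :=
  fun x => \sum_i A i * \prod_j x j 0 (i j).

Definition hypermatrix_of_form (d n : nat) (K : fieldType) (V : vectType K)
    (b : n.-tuple V) (F : formfun d V) : hypermatrix d n K :=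
  [ffun i : {ffun 'I_d -> 'I_n} => F [ffun j => tnth b (i j)]].

Definition hyperpoly (d n : nat) : Type :=
  {mpoly int[#|{ffun 'I_d -> 'I_n}|]}.

Definition hyperpoly_eval (d n : nat) (K : fieldType) (D : hyperpoly d n)
    (A : hypermatrix d n K) : K :=
  mmap (intr : int -> K) (fun k => A (enum_val k)) D.

(* D is the hyperdeterminant of format n x ... x n (d factors), in the sense of
   Gelfand, Kapranov and Zelevinsky: the polynomial, irreducible over the
   integers and therefore unique up to sign, whose zero set in characteristic 0
   is the cone over the projective dual of the Segre variety
   P^(n-1) x ... x P^(n-1).  The hyperplane A = 0 is tangent to the Segre
   variety at (v_1, ..., v_d) exactly when all the partial forms
   A(v_1, ..., w, ..., v_d) vanish.  For d >= 2 and n >= 1 such a D exists.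
   Over an arbitrary field, D is evaluated through the canonical map from the
   integers. *)
Definition is_hyperdeterminant (d n : nat) (D : hyperpoly d n) : Prop :=
  [/\ D != 0,
      D \isn't a GRing.unit,
      forall P Q : hyperpoly d n, D = P * Q ->
        P \is a GRing.unit \/ Q \is a GRing.unit
    & forall A : hypermatrix d n algC,
        hyperpoly_eval D A = 0 <-> degenerate (form_of_hypermatrix A)].

(* Main.v *)
Require Import Defs.
From HB Require Import structures.
From mathcomp Require Import all_boot all_order all_algebra all_fingroup.
From mathcomp Require Import all_field mxrepresentation.
From mathcomp Require Import mpoly.
From mathcomp Require Import ring qpoly.

Set Implicit Arguments.
Unset Strict Implicit.
Unset Printing Implicit Defensive.

Import Order.TTheory GRing.Theory Num.Theory.

Local Open Scope ring_scope.

(** For slots [j], [k] let [E_(j,k) F] be the sum of the forms [g F] over the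
    permutations [g] with [g j = k].  This operator kills every copy of [V_lam]
    in the space of forms, except for [lam = (d)] and [lam = (d-1,1)]: in any
    other Young diagram, whatever box [l] is given, some column contains two
    boxes other than [l], and the transposition of these two boxes fixes [l] but
    changes the sign of the column antisymmetrizer ([young_column_pair],
    [alternating_fibre]).  If [sigma F = c F], then
    [E_(j,k) F = c * E_(sigma j,k) F]; with [c = omega ^ i], this equality hence
    holds for the given [F] ([fibre_sum_covariant]).  Evaluated at the points
    whose coordinates are all equal to [v], but for one equal to [w], it says
    that
      [F_j(v; w) = c * F_(sigma j)(v; w)],
    where [F_j(v; w)] has [w] in slot [j] and [v] in the others.  Since
    [c <> 1], [F(v, ..., v) = 0], and [F] is degenerate as soon as the equations
    [F_j(v; e_m) = 0], for a single [j], have a common solution [v <> 0].  If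
    [v_0 = 1], the equation for [m = 0] can be left out, because
    [sum_m v_m F_j(v; e_m) = F(v, ..., v) = 0] ([heval_covariant]).

    A solution is not sought for [F] itself, but along a segment.  An explicit
    form [M] with the same covariance ([model_hm]) has [M_j(v; e_m)]
    proportional to [v_m] for [m <> 0] when [v_0 = 1], so that [v = e_0] is a
    simple zero; the hypothesis [d >= 3] enters here, through the factor
    [d - 2].  The zero lifts to an exact zero of the form [M + t (F - M)] over
    [K[t]/(t^N)], as the fixed point of a map which is contracting for the
    powers of [t] ([path_fixpoint]).  Now the hyperdeterminant of a hypermatrix
    over any commutative ring vanishes when the hypermatrix is degenerate at a
    vector with [v_0 = 1]: such hypermatrices are parametrized by integer
    polynomials, so the vanishing is a polynomial identity, which can be checked
    at integer points, that is, in characteristic 0 ([heval_degenerate]).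
    Therefore the polynomial [Det (M + t (F - M))] of [K[t]] is divisible by
    every power of [t]; it is zero, and its value at [t = 1] is [Det F]. *)

(** * Polynomials that vanish at all points *)

Lemma poly_eq0_nat (R : numDomainType) (q : {poly R}) :
  (forall k : nat, q.[k%:R] = 0) -> q = 0.
Proof.
move=> q0; apply/eqP; apply: contraT => qN0.
have := max_poly_roots (rs := [seq k%:R | k <- iota 0 (size q)]) qN0.
rewrite size_map size_iota ltnn; apply.
  by apply/allP => _ /mapP[k _ ->]; rewrite /root q0.
by rewrite map_inj_uniq ?iota_uniq // => k l /eqP; rewrite eqr_nat => /eqP.
Qed.

Lemma widen_ord_lift (n : nat) (j : 'I_n) :
  widen_ord (leqnSn n) j = lift ord_max j.
Proof. by apply: val_inj; rewrite /= /bump leqNgt ltn_ord. Qed.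

Lemma mpoly_eq0_points (R : numDomainType) (n : nat) (p : {mpoly R[n]}) :
  (forall v : 'I_n -> R, p.@[v] = 0) -> p = 0.
Proof.
elim: n p => [|n IHn] p p0.
  rewrite [p]mpolyE big_seq big1 // => m _.
  have mE (m' : 'X_{1..0}) : m' = m by apply/mnmP => -[].
  have := p0 (fun=> 0); rewrite mevalE.
  rewrite (eq_bigr (fun=> p@_m)) => [|m' _]; last first.
    by rewrite big_ord0 mulr1 (mE m').
  have [mp|/memN_msupp_eq0->] := boolP (m \in msupp p); last by rewrite scale0r.
  have -> : msupp p = [:: m].
    have := msupp_uniq p; case: (msupp p) mp => // a [|c s] _ /=.
      by rewrite (mE a).
    by rewrite (mE a) (mE c) inE eqxx.
  by rewrite big_seq1 => ->; rewrite scale0r.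
have coefp0 k : (muni p)`_k = 0.
  apply: IHn => v; pose q := map_poly (meval v) (muni p).
  suff q0 : q = 0 by rewrite -coef_map -/q q0 coef0.
  apply: poly_eq0_nat => l.
  pose w (i : 'I_n.+1) := if unlift ord_max i is Some j then v j else l%:R.
  rewrite -(p0 w) mevalE /q muniE rmorph_sum horner_sum.
  apply: eq_bigr => m _; rewrite /= map_polyZ map_polyXn /= mevalZ mevalX.
  rewrite hornerZ hornerXn big_ord_recr /= /w unlift_none mulrA.
  congr (_ * _ * _); apply: eq_bigr => j _.
  by rewrite mnmE widen_ord_lift liftK.
apply/mpolyP => m; rewrite mcoeff0.
have := coefp0 (m ord_max); rewrite muniE coef_sum => /mpolyP.
move=> /(_ [multinom m (widen_ord (leqnSn n) i) | i < n]).
rewrite mcoeff0 raddf_sum /=.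
rewrite (eq_bigr (fun m' => p@_m' *+ (m' == m))).
  have [mp|/memN_msupp_eq0->//] := boolP (m \in msupp p).
  rewrite (bigD1_seq m) ?msupp_uniq //= eqxx mulr1n big1 ?addr0 // => m' m'm.
  by rewrite (negbTE m'm) mulr0n.
move=> m' _; rewrite -mul_polyC coefCM coefXn.
rewrite mulr_natr raddfMn /= mcoeffZ mcoeffX.
have [->|m'm] := eqVneq m' m; first by rewrite !eqxx mulr1.
case: (m ord_max =P m' ord_max) => [em|_] //=.
case: eqP => [/mnmP em'|_]; last by rewrite mulr0.
case/eqP: m'm; apply/mnmP => j; case: (unliftP ord_max j) => [i ->|->] //.
by have := em' i; rewrite !mnmE widen_ord_lift.
Qed.

(** * Hypermatrices over a commutative ring *)

Section Hypermatrices.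
Variables (d n : nat).

(** Evaluation of an integer polynomial at a hypermatrix over any commutative
    ring; over a field this is [hyperpoly_eval]. *)
Definition heval (R : comNzRingType) (D : hyperpoly d n)
    (A : hypermatrix d n R) : R :=
  mmap (intr : int -> R) (fun k => A (enum_val k)) D.

(** The multilinear form on [R^n] of a hypermatrix; the vectors are given by
    their coordinate functions. *)
Definition hform (R : comNzRingType) (A : hypermatrix d n R)
    (x : 'I_d -> 'I_n -> R) : R :=
  \sum_(I : {ffun 'I_d -> 'I_n}) A I * \prod_j x j (I j).

Definition map_hm (R S : comNzRingType) (f : R -> S) (A : hypermatrix d n R) :
    hypermatrix d n S :=
  [ffun I => f (A I)].

(** [x] with [w] in place of its entry of index [j]. *)
Definition upd (T : Type) (x : 'I_d -> T) (j : 'I_d) (w : T) : 'I_d -> T :=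
  fun k => if k == j then w else x k.

Definition unitvec (R : comNzRingType) (m : 'I_n) : 'I_n -> R :=
  fun l => (l == m)%:R.

(** The hypermatrix, in the family of vectors [h], of the form of [A]. *)
Definition hm_change (R : comNzRingType) (A : hypermatrix d n R)
    (h : 'I_n -> 'I_n -> R) : hypermatrix d n R :=
  [ffun I : {ffun 'I_d -> 'I_n} => hform A (fun j => h (I j))].

Lemma eq_hform (R : comNzRingType) (A : hypermatrix d n R) x y :
  (forall j m, x j m = y j m) -> hform A x = hform A y.
Proof.
by move=> xy; apply: eq_bigr => I _; congr (_ * _); apply: eq_bigr => j _.
Qed.

Lemma eq_hm_change (R : comNzRingType) (A : hypermatrix d n R) h h' :
  (forall m l, h m l = h' m l) -> hm_change A h = hm_change A h'.
Proof. by move=> hh'; apply/ffunP => I; rewrite !ffunE; apply: eq_hform. Qed.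

Lemma heval_map (R S : comNzRingType) (f : {rmorphism R -> S}) D
    (A : hypermatrix d n R) :
  heval D (map_hm f A) = f (heval D A).
Proof.
rewrite /heval /mmap rmorph_sum; apply: eq_bigr => m _.
rewrite rmorphM /= rmorph_int; congr (_ * _).
by rewrite rmorph_prod; apply: eq_bigr => k _; rewrite rmorphXn ffunE.
Qed.

Lemma hform_map (R S : comNzRingType) (f : {rmorphism R -> S})
    (A : hypermatrix d n R) x :
  hform (map_hm f A) (fun j m => f (x j m)) = f (hform A x).
Proof.
rewrite rmorph_sum; apply: eq_bigr => I _; rewrite rmorphM ffunE.
by rewrite rmorph_prod.
Qed.

Lemma hm_change_map (R S : comNzRingType) (f : {rmorphism R -> S})
    (A : hypermatrix d n R) h :
  map_hm f (hm_change A h) = hm_change (map_hm f A) (fun m l => f (h m l)).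
Proof. by apply/ffunP => I; rewrite !ffunE -hform_map. Qed.

Lemma hform_change (R : comNzRingType) (A : hypermatrix d n R) h x :
  hform (hm_change A h) x = hform A (fun j l => \sum_m x j m * h m l).
Proof.
rewrite /hform; under eq_bigr do rewrite ffunE mulr_suml.
rewrite exchange_big; apply: eq_bigr => J _ /=.
rewrite bigA_distr_bigA /= mulr_sumr; apply: eq_bigr => I _.
by rewrite -mulrA; congr (_ * _); rewrite -big_split; apply: eq_bigr => j _;
  rewrite mulrC.
Qed.

Lemma hform_unitvec (R : comNzRingType) (A : hypermatrix d n R)
    (I : {ffun 'I_d -> 'I_n}) :
  hform A (fun j => unitvec R (I j)) = A I.
Proof.
rewrite /hform (bigD1 I) //= big1 => [|j _]; last by rewrite /unitvec eqxx.
rewrite mulr1 big1 ?addr0 // => J JI.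
have [j /negbTE jN] : exists j, J j != I j.
  apply/existsP; apply: contraR JI; rewrite negb_exists => /forallP JI.
  by apply/eqP/ffunP => j; apply/eqP; rewrite -[_ == _]negbK.
by rewrite (bigD1 j) //= /unitvec jN mul0r mulr0.
Qed.

Lemma hform_upd (R : comNzRingType) (A : hypermatrix d n R) x j w :
  hform A (upd x j w) = \sum_m w m * hform A (upd x j (unitvec R m)).
Proof.
rewrite /hform; under [RHS]eq_bigr do rewrite mulr_sumr.
rewrite exchange_big; apply: eq_bigr => I _ /=.
rewrite (bigD1 j) //= /upd eqxx.
rewrite [RHS](bigD1 (I j)) //= [X in _ + X]big1 ?addr0; last first.
  move=> m mI; rewrite (bigD1 j) //= eqxx /unitvec eq_sym (negbTE mI).
  by rewrite mul0r !mulr0.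
rewrite [in RHS](bigD1 j) //= eqxx /unitvec eqxx mul1r mulrCA.
congr (_ * (_ * _)).
by apply: eq_bigr => k /negbTE ->.
Qed.

End Hypermatrices.

(** * Vanishing of the hyperdeterminant at degenerate hypermatrices *)

Section Degenerate.
Variables (d n : nat).

(** The unipotent matrix with rows [(1, v_1, ..., v_n)], [e_1], ..., [e_n]: it
    sends [e_0] to [v] when [v 0 = 1], and its inverse is the shear of [- v].
    The value of [v] at 0 is ignored. *)
Definition shear (R : comNzRingType) (v : 'I_n.+1 -> R) (m l : 'I_n.+1) : R :=
  if (m == 0) && (l != 0) then v l else (l == m)%:R.

(** [B] with the entries whose index has at most one nonzero component replaced
    by 0.  The hypermatrices [mask B] are those that are degenerate at
    [(e_0, ..., e_0)]. *)
Definition mask (R : comNzRingType) (B : hypermatrix d n.+1 R) :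
    hypermatrix d n.+1 R :=
  [ffun I : {ffun 'I_d -> 'I_n.+1} =>
     if [exists j, forall k, (k != j) ==> (I k == 0)] then 0 else B I].

Lemma shearE (R : comNzRingType) (u x : 'I_n.+1 -> R) l :
  \sum_m x m * shear u m l = x l + (l != 0)%:R * x 0 * u l.
Proof.
rewrite (bigD1 l) //= /shear eqxx; case: (eqVneq l 0) => [->|l0] /=.
  rewrite mulr1 !mul0r; congr (_ + _); rewrite big1 // => m m0.
  by rewrite andbF eq_sym (negbTE m0) mulr0.
rewrite mulr1 mul1r; congr (_ + _).
rewrite (bigD1 0) 1?eq_sym //= big1 ?addr0 //= => m /andP[ml m0].
by rewrite (negbTE m0) eq_sym (negbTE ml) mulr0.
Qed.

Lemma map_shear (R S : comNzRingType) (f : {rmorphism R -> S}) u m l :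
  f (shear u m l) = shear (fun k => f (u k)) m l.
Proof. by rewrite /shear; case: ifP => // _; rewrite rmorph_nat. Qed.

Lemma map_mask (R S : comNzRingType) (f : {rmorphism R -> S})
    (B : hypermatrix d n.+1 R) : map_hm f (mask B) = mask (map_hm f B).
Proof.
by apply/ffunP => I; rewrite !ffunE; case: ifP => // _; rewrite rmorph0.
Qed.

Lemma degenerate_mask (K : fieldType) (B : hypermatrix d n.+1 K) u :
  degenerate (form_of_hypermatrix (hm_change (mask B) (shear u))).
Proof.
pose v l : K := shear (fun k => - u k) 0 l.
exists [ffun=> \row_l v l]; split=> [j|j w].
  rewrite ffunE; apply/eqP => /rowP /(_ 0) /eqP.
  by rewrite !mxE /v /shear eqxx oner_eq0.
transitivity (hform (hm_change (mask B) (shear u))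
                (upd (fun=> v) j (fun m => w 0 m))).
  apply: eq_bigr => I _; congr (_ * _); apply: eq_bigr => k _.
  by rewrite !ffunE /upd; case: eqP; rewrite ?mxE.
rewrite hform_change; apply: big1 => I _; rewrite ffunE.
case: ifP => [_|/existsP Ij]; first by rewrite mul0r.
have /existsP [k] : [exists k, ~~ ((k != j) ==> (I k == 0))].
  by rewrite -negb_forall; apply/negP => ?; apply: Ij; exists j.
rewrite negb_imply => /andP[/negbTE kj Ik0].
rewrite (bigD1 k) //= /upd kj shearE /v {1 2}/shear (negbTE Ik0) /=.
by rewrite {1}/shear /= mulr1 mul1r addNr mul0r mulr0.
Qed.

(** An integer polynomial identity in the entries of [B] and [u]: it holds for
    the generic [B] and [u], because it holds for all integer ones, seen in the
    algebraic numbers. *)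
Lemma heval_mask (D : hyperpoly d n.+1) (R : comNzRingType)
    (B : hypermatrix d n.+1 R) u :
  is_hyperdeterminant D -> heval D (hm_change (mask B) (shear u)) = 0.
Proof.
case=> _ _ _ Dalg.
(* T indexes the indeterminates: the entries of B and those of u. *)
pose T := ({ffun 'I_d -> 'I_n.+1} + 'I_n.+1)%type.
pose X : hypermatrix d n.+1 {mpoly int[#|{: T}|]} :=
  [ffun I => 'X_(enum_rank (inl I : T))].
pose Y m : {mpoly int[#|{: T}|]} := 'X_(enum_rank (inr m : T)).
pose P := heval D (hm_change (mask X) (shear Y)).
pose ev (S : comNzRingType) (C : hypermatrix d n.+1 S) (w : 'I_n.+1 -> S) :
    {rmorphism {mpoly int[#|{: T}|]} -> S} :=
  mmap (intr : int -> S) (fun k : 'I_#|{: T}| =>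
    match (enum_val k : T) with inl J => C J | inr m => w m end).
have evP (S : comNzRingType) (C : hypermatrix d n.+1 S) w :
    ev S C w P = heval D (hm_change (mask C) (shear w)).
  rewrite /P -heval_map hm_change_map map_mask; congr heval.
  apply/ffunP => I; rewrite !ffunE.
  have -> : map_hm (ev S C w) X = C.
    by apply/ffunP => J; rewrite !ffunE /= mmapX mmap1U enum_rankK.
  apply: eq_hform => j m; rewrite map_shear /shear; case: ifP => // _.
  by rewrite /= mmapX mmap1U enum_rankK.
suff P0 : P = 0 by rewrite -evP P0 rmorph0.
apply: mpoly_eq0_points => v.
pose C : hypermatrix d n.+1 int := [ffun I => v (enum_rank (inl I : T))].
pose w m := v (enum_rank (inr m : T)).
have -> : P.@[v] = ev _ C w P.
  apply: eq_bigr => m _; rewrite /= intz; congr (_ * _).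
  apply: eq_bigr => k _; rewrite -{1}[k]enum_valK.
  by case: (enum_val k) => [J|l] /=; rewrite ?ffunE.
apply/eqP; rewrite -(intr_eq0 algC) evP; apply/eqP.
rewrite -[LHS]heval_map hm_change_map map_mask.
rewrite -[LHS]/(hyperpoly_eval D _); apply/Dalg.
rewrite (eq_hm_change _ (map_shear _ w)); exact: degenerate_mask.
Qed.

Lemma heval_degenerate (D : hyperpoly d n.+1) (R : comNzRingType)
    (A : hypermatrix d n.+1 R) (v : 'I_n.+1 -> R) :
    (0 < d)%N -> is_hyperdeterminant D -> v 0 = 1 ->
    (forall j m, hform A (upd (fun=> v) j (unitvec R m)) = 0) ->
  heval D A = 0.
Proof.
move=> d_gt0 Ddet v0 Av0.
have shv m l : \sum_k shear (fun k => - v k) m k * shear v k l = (l == m)%:R.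
  rewrite shearE /shear; case: (eqVneq m 0) => [->|m0] /=; last first.
    by rewrite mulr0 mul0r addr0.
  case: (eqVneq l 0) => [_|_] /=; first by rewrite !mul0r addr0.
  by rewrite !mul1r addNr.
have AE : A = hm_change (hm_change A (shear v)) (shear (fun k => - v k)).
  apply/ffunP => I; rewrite ffunE hform_change -[LHS]hform_unitvec.
  by apply: eq_hform => j m; rewrite shv.
have -> : A = hm_change (mask (hm_change A (shear v))) (shear (fun k => - v k)).
  rewrite {1}AE; congr hm_change; apply/ffunP => I; rewrite [RHS]ffunE.
  case: existsP => // -[j /forallP Ij]; rewrite ffunE.
  transitivity (hform A (upd (fun=> v) j (shear v (I j)))); last first.
    by rewrite hform_upd big1 // => m _; rewrite Av0 mulr0.
  apply: eq_hform => k m; rewrite /upd; case: eqVneq => [->//|kj].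
  have := Ij k; rewrite kj => /eqP ->; rewrite /shear /=.
  by case: eqVneq => //= ->; rewrite v0.
exact: heval_mask.
Qed.
End Degenerate.

(** * Isotypic components and sums over the permutations mapping j to k *)

Lemma young_box (d : nat) (lam : seq nat) (r c : nat) :
    sumn lam = d -> (c < nth 0 lam r)%N ->
  exists2 x : 'I_d, reshape_index lam x = r & reshape_offset lam x = c.
Proof.
move=> lamd ltc; have ltd : (flatten_index lam r c < d)%N.
  by rewrite -lamd flatten_indexP.
by exists (Ordinal ltd); [apply: flatten_indexKl | apply: flatten_indexKr].
Qed.

(** The only Young diagrams with a box [l] such that every column has at most
    one box other than [l] are those of [(d)] and [(d-1,1)]. *)
Lemma young_column_pair (d : nat) (lam : seq nat) (l : 'I_d) :
    is_partition d lam -> lam <> [:: d] -> lam <> [:: d.-1; 1%N] ->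
  exists a b : 'I_d, [/\ a != b, l != a, l != b
    & reshape_offset lam a = reshape_offset lam b].
Proof.
case=> lam_sorted lam0 lamd lamN1 lamN2.
have row_neq (x y : 'I_d) r s : r != s -> reshape_index lam x = r ->
    reshape_index lam y = s -> x != y.
  by move=> rs xr ys; apply: contraNneq rs => xy; rewrite -xr -ys xy.
have box := young_box lamd.
case: lam => [|r0 [|r1 s]] in lam_sorted lam0 lamd lamN1 lamN2 row_neq box *.
- by case: l => l ltld; exfalso; rewrite -lamd in ltld.
- by case: lamN1; rewrite -lamd /= addn0.
have /andP[r1r0 s_sorted] := lam_sorted.
move: lam0; rewrite !inE => /norP[r0_gt0 /norP[r1_gt0 s0]].
move: r0_gt0 r1_gt0; rewrite ![0%N == _]eq_sym -!lt0n => r0_gt0 r1_gt0.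
have [a0 a0r a0c] := box 0%N 0%N r0_gt0.
have [b0 b0r b0c] := box 1%N 0%N r1_gt0.
have ab0 : a0 != b0 by apply: row_neq a0r b0r.
(* The first two columns both have two boxes, and one of them avoids l. *)
have [r1_gt1|r1_le1] := ltnP 1 r1.
  have [a1 a1r a1c] := box 0%N 1%N (leq_trans r1_gt1 r1r0).
  have [b1 b1r b1c] := box 1%N 1%N r1_gt1.
  have ab1 : a1 != b1 by apply: row_neq a1r b1r.
  have [l0|l0] := boolP ((l != a0) && (l != b0)).
    by case/andP: l0; exists a0, b0; rewrite a0c b0c.
  have lc : reshape_offset [:: r0, r1 & s] l = 0%N.
    by move: l0; rewrite negb_and !negbK => /orP[] /eqP->.
  exists a1, b1; rewrite a1c b1c; split=> //.
    by apply: contra_eqN a1c => /eqP <-; rewrite lc.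
  by apply: contra_eqN b1c => /eqP <-; rewrite lc.
(* Otherwise the first column has at least three boxes. *)
have r11 : r1 = 1%N by apply/eqP; rewrite eqn_leq r1_le1.
case: s => [|r2 s] in lam_sorted s_sorted s0 lamd lamN1 lamN2 row_neq box
  a0r a0c b0r b0c *.
  by case: lamN2; rewrite -lamd r11 /= addn0 addn1.
have r2_gt0 : (0 < r2)%N.
  by move: s0; rewrite inE eq_sym => /norP[]; rewrite -lt0n.
have [c0 c0r c0c] := box 2%N 0%N r2_gt0.
have ac0 : a0 != c0 by apply: row_neq a0r c0r.
have bc0 : b0 != c0 by apply: row_neq b0r c0r.
have [la0|la0] := eqVneq l a0.
  by exists b0, c0; rewrite b0c c0c la0.
have [lb0|lb0] := eqVneq l b0.
  by exists a0, c0; rewrite a0c c0c la0 lb0.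
by exists a0, b0; rewrite a0c b0c.
Qed.

Section Fibres.
Variables (d : nat) (K : fieldType) (m : nat).
Local Notation G := [set: 'S_d]%G.
Variable rG : mx_representation K G m.

(** The action of the sum of the permutations that map [j] to [k]. *)
Definition fibre_mx (j k : 'I_d) : 'M[K]_m :=
  \sum_(g : 'S_d | g j == k) rG g.

Lemma mulmx_fibre (h : 'S_d) j k :
  rG h *m fibre_mx j k = fibre_mx ((h^-1)%g j) k.
Proof.
rewrite /fibre_mx mulmx_sumr [RHS](reindex_inj (mulgI h)) /=.
by apply: eq_big => [g|g _]; rewrite ?permM ?permKV // repr_mxM ?inE.
Qed.

Lemma mulmx_fibre_lin (c : 'S_d -> K) j k :
  (\sum_(g in G) c g *: rG g) *m fibre_mx j k =
    \sum_(g in G) c g *: fibre_mx ((g^-1)%g j) k.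
Proof.
rewrite mulmx_suml; apply: eq_bigr => g _.
by rewrite -[LHS]scalemxAl mulmx_fibre.
Qed.

(** The transposition of [a] and [b] belongs to the column group and fixes [l]:
    it leaves [fibre_mx l k] unchanged and negates the alternating sum. *)
Lemma alternating_fibre (lam : seq nat) (l k a b : 'I_d) :
    2%:R != 0 :> K ->
    a != b -> l != a -> l != b ->
    reshape_offset lam a = reshape_offset lam b ->
  (\sum_(q in col_group d lam) (-1) ^+ odd_perm q *: rG q) *m fibre_mx l k = 0.
Proof.
move=> two ab la lb oab; set S := (\sum_(q in _) _) *m _.
suff SN : S = - S.
  apply/eqP; move/eqP: SN; rewrite -addr_eq0 -mulr2n -scaler_nat scaler_eq0.
  by rewrite (negbTE two).
rewrite -mulNmx -sumrN /S (reindex_inj (mulIg (tperm a b))) /= !mulmx_suml.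
have colM q : (q * tperm a b \in col_group d lam)%g = (q \in col_group d lam).
  rewrite !inE; apply: eq_forallb => i; rewrite permM.
  by case: tpermP => [->|->|//]; rewrite oab.
apply: eq_big => // q _.
rewrite odd_permM odd_tperm ab signr_addb mulrN1 scaleNr repr_mxM ?inE //.
rewrite !mulNmx; congr (- _).
rewrite -[LHS]scalemxAl -[RHS]scalemxAl; congr (_ *: _).
by rewrite -mulmxA mulmx_fibre tpermV tpermD 1?eq_sym.
Qed.

End Fibres.

Lemma irr_module_fibre (d : nat) (K : fieldType) (lam : seq nat)
    (u : 'rV[K]_#|[set: 'S_d]%G|) j k :
    2%:R != 0 :> K ->
    is_partition d lam -> lam <> [:: d] -> lam <> [:: d.-1; 1%N] ->
    (u <= irr_module d K lam)%MS ->
  u *m fibre_mx (regular_repr K [set: 'S_d]%G) j k = 0.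
Proof.
move=> two lamP lamN1 lamN2 /cyclic_mxP[A /envelop_mxP[c ->] ->].
rewrite -mulmxA mulmx_fibre_lin mulmx_sumr big1 // => g _.
rewrite -scalemxAr.
set l0 := (_ j); rewrite /young_symmetrizer mulmx_suml big1 ?scaler0 // => p _.
have [a [b [ab la lb oab]]] := young_column_pair ((p^-1)%g l0) lamP lamN1 lamN2.
set G := [set: 'S_d]%G; set rG := regular_repr K G.
have dE q : delta_mx 0 (gring_index G (q * p)%g) =
    delta_mx 0 (gring_index G 1%g) *m rG q *m rG p :> 'rV[K]_#|G|.
  rewrite -mulmxA -repr_mxM ?inE // -rowE rowK gring_indexK ?inE //.
  by rewrite mul1g.
under eq_bigr do rewrite dE scalemxAl scalemxAr.
rewrite -mulmx_suml -mulmx_sumr -!mulmxA mulmx_fibre.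
by rewrite (alternating_fibre _ _ two ab la lb oab) mulmx0.
Qed.

(** The same sum of permutations, acting on forms. *)
Definition fibre_sum (d : nat) (K : fieldType) (V : lmodType K)
    (F : formfun d V) (j k : 'I_d) : formfun d V :=
  fun x => \sum_(g : 'S_d | g j == k) perm_form g F x.

Lemma fibre_sum_isotypic (d : nat) (K : fieldType) (V : lmodType K)
    (lam : seq nat) (F : formfun d V) j k x :
    2%:R != 0 :> K ->
    is_partition d lam -> lam <> [:: d] -> lam <> [:: d.-1; 1%N] ->
    isotypic lam F ->
  fibre_sum F j k x = 0.
Proof.
move=> two lamP lamN1 lamN2 [m [H [HU FE]]].
have -> : fibre_sum F j k x = \sum_i fibre_sum (H i) j k x.
  rewrite exchange_big; apply: eq_bigr => g _ /=.
  by rewrite /perm_form FE.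
apply: big1 => i _.
have [U [_ [phi [phiL phiM _ phiU]]] /phiU[u uV HE]] := HU i.
pose L : {scalar _} := HB.pack (fun v => phi v x)
  (GRing.isLinear.Build _ _ _ _ (fun v => phi v x) (phiL x)).
transitivity (L (u *m fibre_mx (regular_repr K _) j k)); last first.
  by rewrite (irr_module_fibre j k two lamP lamN1 lamN2 uV) raddf0.
rewrite /fibre_mx mulmx_sumr raddf_sum; apply: eq_bigr => g _ /=.
by rewrite phiM // /perm_form HE.
Qed.

Lemma fibre_sum_eigen (d : nat) (K : fieldType) (V : lmodType K)
    (sigma : 'S_d) (c : K) (F : formfun d V) j k x :
    (forall y, perm_form sigma F y = c * F y) ->
  fibre_sum F j k x = c * fibre_sum F (sigma j) k x.
Proof.
move=> Fc; rewrite /fibre_sum mulr_sumr (reindex_inj (mulgI sigma)) /=.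
apply: eq_big => [g|g _]; first by rewrite permM.
rewrite {2}/perm_form -Fc /perm_form; congr F.
by apply/ffunP => l; rewrite !ffunE permM.
Qed.

(** The covariance shared by all the forms of the subspace under
    consideration. *)
Lemma fibre_sum_covariant (d : nat) (K : fieldType) (omega : K) (V : lmodType K)
    (sigma : 'S_d) (i : nat) (F : formfun d V) :
    2%:R != 0 :> K ->
    sum_of_subspaces
      (fun U : formfun d V -> Prop =>
         (exists lam : seq nat,
            [/\ is_partition d lam, lam <> [:: d], lam <> [:: d.-1; 1%N]
              & U = isotypic lam])
         \/ U = std_eigen sigma omega i) F ->
  forall j k x,
    fibre_sum F j k x = omega ^+ i * fibre_sum F (sigma j) k x.
Proof.
move=> two [m [H [HU FE]]] j k x.
have sumE l : fibre_sum F l k x = \sum_a fibre_sum (H a) l k x.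
  by rewrite exchange_big; apply: eq_bigr => g _; rewrite /perm_form FE.
rewrite !sumE mulr_sumr; apply: eq_bigr => a _.
have [U [[lam [lamP lamN1 lamN2 ->]]|->] Ha] := HU a.
  by rewrite !(fibre_sum_isotypic _ _ _ two lamP lamN1 lamN2 Ha) mulr0.
by have [_ Hs] := Ha; apply: fibre_sum_eigen.
Qed.

(** * Forms with one distinguished argument *)

(** The number [(d - 1)!] of permutations that map [j] to [k]. *)
Definition fibre_card (d : nat) (j k : 'I_d) : nat :=
  #|[pred g : 'S_d | g j == k]|.

Lemma fibre_card_const (d : nat) (j k j' k' : 'I_d) :
  fibre_card j k = fibre_card j' k'.
Proof.
pose f (g : 'S_d) := (tperm j j' * g * tperm k k')%g.
have f_inj : injective f by move=> g h /mulIg /mulgI.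
rewrite /fibre_card -(card_image f_inj); apply: eq_card => g.
have -> : g = f (tperm j j' * g * tperm k k')%g.
  by rewrite /f !mulgA tperm2 mul1g -mulgA tperm2 mulg1.
rewrite mem_image // !inE !permM tpermL.
rewrite -[X in _ == X](tpermR k k') (inj_eq perm_inj).
by rewrite !tpermK.
Qed.

Lemma fibre_cardM (d : nat) (j k : 'I_d) : (d * fibre_card j k)%N = d`!.
Proof.
rewrite -card_Sn -sum1_card (partition_big (fun g : 'S_d => g j) predT) //=.
transitivity (\sum_(l < d) fibre_card j k)%N.
  by rewrite sum_nat_const card_ord.
apply: eq_bigr => l _.
by rewrite (fibre_card_const j k j l) /fibre_card -sum1_card.
Qed.

Section HformFibres.
Variables (d n : nat) (R : comNzRingType).

Lemma hform_fibre (A : hypermatrix d n R) j k v w :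
  (fibre_card j k)%:R * hform A (upd (fun=> v) j w) =
    \sum_(I : {ffun 'I_d -> 'I_n})
      (\sum_(g : 'S_d | g j == k) A [ffun l => I (g l)]) *
      \prod_l upd (fun=> v) k w l (I l).
Proof.
under [RHS]eq_bigr do rewrite mulr_suml.
rewrite exchange_big /fibre_card -sum1_card natr_sum mulr_suml.
apply: eq_bigr => g /eqP gj.
pose h (I : {ffun 'I_d -> 'I_n}) : {ffun 'I_d -> 'I_n} := [ffun l => I (g l)].
have h_bij : bijective h.
  exists (fun I : {ffun 'I_d -> 'I_n} => [ffun l => I (g^-1%g l)]) => I;
    by apply/ffunP => l; rewrite !ffunE ?permK ?permKV.
rewrite mul1r /hform (reindex h) /=; last exact: onW_bij.
apply: eq_bigr => I _; congr (_ * _).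
rewrite [RHS](reindex_inj (@perm_inj _ g)) /=; apply: eq_bigr => l _.
by rewrite ffunE /upd -gj (inj_eq perm_inj).
Qed.

(** The form [F] of [A] satisfies [F_j(v; w) = c * F_(sigma j)(v; w)]. *)
Definition cyclic_covariant (sigma : 'S_d) (c : R)
    (A : hypermatrix d n R) :=
  forall v w j, hform A (upd (fun=> v) j w) =
    c * hform A (upd (fun=> v) (sigma j) w).

Lemma cyclic_covariant_fibre (sigma : 'S_d) (c e : R) (A : hypermatrix d n R) :
    e * (d`!)%:R = 1 ->
    (forall j k I, \sum_(g : 'S_d | g j == k) A [ffun l => I (g l)] =
       c * \sum_(g : 'S_d | g (sigma j) == k) A [ffun l => I (g l)]) ->
  cyclic_covariant sigma c A.
Proof.
move=> ed Ac v w j.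
rewrite -[LHS]mul1r -[RHS]mul1r -ed -(fibre_cardM j j) natrM -!mulrA.
congr (_ * (_ * _)); rewrite hform_fibre.
rewrite mulrCA (fibre_card_const j j (sigma j) j) hform_fibre mulr_sumr.
by apply: eq_bigr => I _; rewrite Ac mulrA.
Qed.

End HformFibres.

(** * A covariant hypermatrix with a simple zero *)

Section Model.
Variables (d n : nat) (R : comNzRingType).

(** The index with [m] in slots [p] and [q], and 0 elsewhere. *)
Definition pair_index (p q : 'I_d) (m : 'I_n.+1) : {ffun 'I_d -> 'I_n.+1} :=
  [ffun k => if (k == p) || (k == q) then m else 0].

(** The form mapping [x] to the sum, over the slots [p <> q] and over [m <> 0],
    of [z_p * x_(p,m) * x_(q,m)] times the product of the [x_(k,0)] for the
    other slots [k]. *)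
Definition model_hm (z : 'I_d -> R) : hypermatrix d n.+1 R :=
  [ffun I => \sum_p \sum_(q | q != p) z p *
               \sum_(m | m != 0) (I == pair_index p q m)%:R].

Lemma hform_model (z : 'I_d -> R) x :
  hform (model_hm z) x =
    \sum_p \sum_(q | q != p) z p *
      \sum_(m | m != 0) \prod_k x k (pair_index p q m k).
Proof.
rewrite /hform; under eq_bigr do rewrite ffunE mulr_suml.
rewrite exchange_big; apply: eq_bigr => p _ /=.
under eq_bigr do rewrite mulr_suml.
rewrite exchange_big; apply: eq_bigr => q _ /=.
under eq_bigr do rewrite -mulrA mulr_suml.
rewrite -mulr_sumr exchange_big; congr (_ * _); apply: eq_bigr => m _ /=.
rewrite (bigD1 (pair_index p q m)) //= eqxx mul1r.
rewrite [X in _ + X]big1 ?addr0 // => I.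
by move=> /negbTE->; rewrite mul0r.
Qed.

Lemma prod_pair_index (p q j : 'I_d) m (v w : 'I_n.+1 -> R) :
    p != q -> v 0 = 1 ->
  \prod_k upd (fun=> v) j w k (pair_index p q m k) =
    if (j == p) || (j == q) then w m * v m else w 0 * v m ^+ 2.
Proof.
move=> pq v0; rewrite (bigD1 p) //= (bigD1 q) 1?eq_sym //= /upd !ffunE.
rewrite !eqxx orbT /= [q == j]eq_sym [p == j]eq_sym.
set P := \prod_(k < d | _) _.
have P1 : P = if (j == p) || (j == q) then 1 else w 0.
  rewrite /P; have [jpq|] := boolP ((j == p) || (j == q)).
    apply: big1 => k /andP[kp kq]; rewrite ffunE (negbTE kp) (negbTE kq) /=.
    by case: eqP => // kj; rewrite -kj (negbTE kp) (negbTE kq) in jpq.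
  rewrite negb_or => /andP[jp jq]; rewrite (bigD1 j) ?jp //= eqxx.
  rewrite ffunE (negbTE jp) (negbTE jq) big1 ?mulr1 // => k.
  case/andP=> /andP[kp kq] /negbTE->.
  by rewrite ffunE (negbTE kp) (negbTE kq).
rewrite {}P1; have [->|jp] := eqVneq j p; first by rewrite (negbTE pq) mulr1.
have [_|_] /= := eqVneq j q; first by rewrite mulr1 mulrC.
by rewrite mulrA mulrC expr2.
Qed.

Lemma hform_model_upd (z : 'I_d -> R) (v w : 'I_n.+1 -> R) j :
    (1 < d)%N -> \sum_p z p = 0 -> v 0 = 1 ->
  hform (model_hm z) (upd (fun=> v) j w) =
    (d - 2)%:R * z j *
      (\sum_(m | m != 0) w m * v m - w 0 * \sum_(m | m != 0) v m ^+ 2).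
Proof.
move=> d_gt1 z0 v0; rewrite hform_model.
set s := \sum_(m | _) w m * v m; set r := w 0 * _.
have cardN p : #|[pred q : 'I_d | q != p]| = (d - 2).+1.
  by rewrite (cardC1 p) card_ord subn2 prednK // -ltnS prednK // ltnW.
have termE p q : q != p ->
    z p * \sum_(m | m != 0) \prod_k upd (fun=> v) j w k (pair_index p q m k) =
    z p * (if (j == p) || (j == q) then s else r).
  move=> qp; congr (_ * _); rewrite /s /r mulr_sumr.
  have pq : p != q by rewrite eq_sym.
  under eq_bigr do rewrite prod_pair_index //.
  by case: ifP.
under eq_bigr => p _ do
  (rewrite (eq_bigr _ (fun q qp => termE p q qp)) -mulr_sumr).
(* The sum over q is (d - 1) s for p = j, and s + (d - 2) r for p <> j. *)
rewrite (bigD1 j) //= (eq_bigr (fun=> s)) => [|q _]; last by rewrite eqxx.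
rewrite sumr_const cardN.
rewrite (eq_bigr (fun p => z p * (s + r *+ (d - 2)))) => [|p pj]; last first.
  have jp : j != p by rewrite eq_sym.
  congr (_ * _); rewrite (bigD1 j) //= eqxx orbT; congr (_ + _).
  rewrite (eq_bigr (fun=> r)) => [|q /andP[_ qj]]; last first.
    by rewrite (negbTE jp) eq_sym (negbTE qj).
  rewrite sumr_const; congr (_ *+ _); apply/eqP; rewrite -eqSS -(cardN p).
  rewrite [X in _ == X](cardD1 j) !inE jp add1n eqSS; apply/eqP/eq_card => q.
  by rewrite !inE andbC.
rewrite -mulr_suml; have -> : \sum_(p < d | p != j) z p = - z j.
  by have := z0; rewrite (bigD1 j) //= addrC => /eqP; rewrite addr_eq0 => /eqP.
rewrite mulNr -mulrBr mulrS opprD addrACA subrr add0r -mulrnBl.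
by rewrite mulrnAr -mulr_natl mulrA.
Qed.

Lemma model_covariant (sigma : 'S_d) (c : R) (z : 'I_d -> R) v w j :
    (1 < d)%N -> \sum_p z p = 0 -> (forall p, z p = c * z (sigma p)) ->
    v 0 = 1 ->
  hform (model_hm z) (upd (fun=> v) j w) =
    c * hform (model_hm z) (upd (fun=> v) (sigma j) w).
Proof.
move=> d_gt1 z0 zc v0; rewrite !hform_model_upd // [z j]zc.
by rewrite !mulrA [_ * c]mulrC.
Qed.

End Model.

Lemma map_model (d n : nat) (R S : comNzRingType) (f : {rmorphism R -> S})
    (z : 'I_d -> R) :
  map_hm f (model_hm n z) = model_hm n (fun p => f (z p)).
Proof.
apply/ffunP => I; rewrite !ffunE rmorph_sum; apply: eq_bigr => p _.
rewrite rmorph_sum; apply: eq_bigr => q _; rewrite rmorphM rmorph_sum.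
by congr (_ * _); apply: eq_bigr => m _; rewrite rmorph_nat.
Qed.

(** * Lifting the zero along a segment *)

(** Congruence modulo the ideal generated by [a]. *)
Definition cong (R : comNzRingType) (a x y : R) : Prop :=
  exists r, x = y + a * r.

Lemma cong_hform (d n : nat) (R : comNzRingType) (a : R)
    (A : hypermatrix d n R) x y :
    (forall j m, cong a (x j m) (y j m)) ->
  cong a (hform A x) (hform A y).
Proof.
have cong0 s : cong a s s by exists 0; rewrite mulr0 addr0.
move=> xy; apply: (big_ind2 (cong a)) => // [u1 v1 u2 v2 [r ->] [s ->]|I _].
  by exists (r + s); rewrite mulrDr addrACA.
suff [r ->] : cong a (\prod_j x j (I j)) (\prod_j y j (I j)).
  by exists (A I * r); rewrite mulrDr mulrCA.
apply: (big_ind2 (cong a)) => // u1 v1 u2 v2 [r ->] [s ->].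
exists (v1 * s + r * v2 + r * (a * s)).
by ring.
Qed.

(** The point [A + t B] of the line through [A] with direction [B]. *)
Definition path_hm (d n : nat) (R : comNzRingType) (A : hypermatrix d n R)
    (t : R) (B : hypermatrix d n R) : hypermatrix d n R :=
  [ffun I => A I + t * B I].

Lemma hform_path (d n : nat) (R : comNzRingType) (A B : hypermatrix d n R) t x :
  hform (path_hm A t B) x = hform A x + t * hform B x.
Proof.
rewrite mulr_sumr -big_split; apply: eq_bigr => I _.
by rewrite ffunE mulrDl mulrA.
Qed.

Lemma map_path_hm (d n : nat) (R S : comNzRingType) (f : {rmorphism R -> S})
    (A B : hypermatrix d n R) t :
  map_hm f (path_hm A t B) = path_hm (map_hm f A) (f t) (map_hm f B).
Proof. by apply/ffunP => I; rewrite !ffunE rmorphD rmorphM. Qed.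

(** For [m <> 0] the equation reads [kappa v_m + t b_m(v) = 0] with [b_m] a
    polynomial map, that is, [v = step v].  As [t] is nilpotent, the iteration
    of [step] is eventually stationary. *)
Lemma path_fixpoint (d n : nat) (R : comNzRingType)
    (A B : hypermatrix d n.+1 R) (j0 : 'I_d) (t kappa kappa' : R) (N : nat) :
    t ^+ N = 0 -> kappa * kappa' = 1 ->
    (forall v m, v 0 = 1 -> m != 0 ->
       hform A (upd (fun=> v) j0 (unitvec R m)) = kappa * v m) ->
  exists2 v : 'I_n.+1 -> R, v 0 = 1 &
    forall m, m != 0 ->
      hform (path_hm A t B) (upd (fun=> v) j0 (unitvec R m)) = 0.
Proof.
move=> tN kk' Ak.
pose step (v : 'I_n.+1 -> R) m := if m == 0 then 1 else
  - (kappa' * t * hform B (upd (fun=> v) j0 (unitvec R m))).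
pose u k := iter k step (unitvec R 0).
have step_cong k m : cong (t ^+ k) (u k.+1 m) (u k m).
  elim: k m => [|k IHk] m.
    by exists (u 1%N m - u 0%N m); rewrite expr0 mul1r addrC subrK.
  rewrite [u k.+2]iterS -/(u k.+1) [u k.+1 in X in cong _ _ X]iterS -/(u k).
  rewrite /step; case: eqP => _; first by exists 0; rewrite mulr0 addr0.
  have [|r ->] := @cong_hform d n.+1 R (t ^+ k) B
      (upd (fun=> u k.+1) j0 (unitvec R m)) (upd (fun=> u k) j0 (unitvec R m)).
    move=> j l; rewrite /upd; case: eqP => _ //.
    by exists 0; rewrite mulr0 addr0.
  exists (- (kappa' * r)).
  rewrite mulrDr opprD mulrN; congr (_ - _).
  by rewrite exprS -!mulrA mulrCA; congr (_ * _); rewrite mulrCA.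
have uN m : u N.+1 m = u N m.
  by have [r ->] := step_cong N m; rewrite tN mul0r addr0.
exists (u N) => [|m m0]; first by rewrite -uN.
rewrite hform_path Ak //; last by rewrite -uN.
rewrite -{1}uN [u N.+1]iterS -/(u N) /step (negbTE m0).
by rewrite mulrN !mulrA kk' mul1r addNr.
Qed.

Lemma full_cycleP (d : nat) (sigma : 'S_d) :
  is_full_cycle sigma -> forall j, porbit sigma j = setT.
Proof.
move=> sP j; have : porbit sigma j \in porbits sigma by apply: imset_f.
by rewrite sP inE => /eqP.
Qed.

(** The invertibility of [c] and [1 - c] is expressed by [cc'] and [c1_inv]. *)
Section Path.
Variables (d n : nat) (D : hyperpoly d n.+1) (sigma : 'S_d).
Hypotheses (d_gt0 : (0 < d)%N) (Ddet : is_hyperdeterminant D).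
Hypothesis sigma_full : is_full_cycle sigma.
Variables (R : comNzRingType) (c c' e : R).
Hypotheses (cc' : c' * c = 1) (c1_inv : e * (1 - c) = 1).

(** By covariance it suffices to consider one slot [j0].  The equation for
    [m = 0] follows from the other ones, because [v 0 = 1] and the form vanishes
    at [(v, ..., v)]. *)
Lemma heval_covariant (A : hypermatrix d n.+1 R) (j0 : 'I_d)
    (v : 'I_n.+1 -> R) :
    v 0 = 1 ->
    (forall w j, hform A (upd (fun=> v) j w) =
       c * hform A (upd (fun=> v) (sigma j) w)) ->
    (forall m, m != 0 -> hform A (upd (fun=> v) j0 (unitvec R m)) = 0) ->
  heval D A = 0.
Proof.
move=> v0 Ac Av.
have Avv : hform A (fun=> v) = 0.
  have updv j : hform A (upd (fun=> v) j v) = hform A (fun=> v).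
    by apply: eq_hform => k m; rewrite /upd; case: eqP.
  have := Ac v j0; rewrite !updv => /eqP.
  rewrite -subr_eq0 -{1}[hform _ _]mul1r -mulrBl => /eqP A1.
  by rewrite -[LHS]mul1r -c1_inv -mulrA A1 mulr0.
have Av0 m : hform A (upd (fun=> v) j0 (unitvec R m)) = 0.
  have [->|/Av//] := eqVneq m 0.
  have : hform A (upd (fun=> v) j0 v) = 0.
    by rewrite -[RHS]Avv; apply: eq_hform => k l; rewrite /upd; case: eqP.
  rewrite hform_upd (bigD1 0) //= v0 mul1r big1 ?addr0 // => l l0.
  by rewrite Av // mulr0.
apply: (heval_degenerate d_gt0 Ddet v0) => j m.
have : j \in porbit sigma j0 by rewrite full_cycleP ?inE.
case/porbitP => a ->; elim: a => [|a IHa]; first by rewrite perm1 Av0.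
by rewrite expgSr permM -[LHS]mul1r -cc' -mulrA -Ac IHa mulr0.
Qed.

(** With [M] the hypermatrix of the model, the hypermatrix considered is
    [M + t (B - M)]. *)
Lemma heval_path (z : 'I_d -> R) (B : hypermatrix d n.+1 R) j0 t k' N :
    (1 < d)%N -> t ^+ N = 0 -> (d - 2)%:R * z j0 * k' = 1 ->
    (forall p, z p = c * z (sigma p)) -> cyclic_covariant sigma c B ->
  heval D (path_hm (model_hm n z) t (path_hm B (-1) (model_hm n z))) = 0.
Proof.
move=> d_gt1 tN zk zc Bc.
have z0 : \sum_p z p = 0.
  have zE : \sum_p z p = c * \sum_p z p.
    rewrite mulr_sumr [RHS](reindex_inj (@perm_inj _ sigma)) /=.
    by apply: eq_bigr => p _.
  by rewrite -[LHS]mul1r -c1_inv -mulrA mulrBl mul1r -zE subrr mulr0.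
set C := path_hm B _ _.
have model_j0 (v : 'I_n.+1 -> R) m : v 0 = 1 -> m != 0 ->
    hform (model_hm n z) (upd (fun=> v) j0 (unitvec R m)) =
      (d - 2)%:R * z j0 * v m.
  move=> v0 m0; rewrite hform_model_upd // /unitvec eq_sym (negbTE m0) mul0r.
  rewrite subr0 (bigD1 m) //= eqxx mul1r big1 ?addr0 // => l /andP[_ lm].
  by rewrite (negbTE lm) mul0r.
have [v v0 vP] := path_fixpoint C tN zk model_j0.
apply: (heval_covariant v0 _ vP) => w j.
rewrite !hform_path Bc (model_covariant _ _ d_gt1 z0 zc v0).
by ring.
Qed.
End Path.

(** * The hyperdeterminant of a covariant hypermatrix *)

(** The weights are [z (sigma^a j0) = c ^ - a]; the formula in the proof
    avoids choosing [a], [z j] being the sum of the [c ^ a] for the [a < d]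
    such that [sigma^a j = j0]. *)
Lemma cyclic_weights (d : nat) (R : comNzRingType) (sigma : 'S_d) (c : R)
    (j0 : 'I_d) :
    is_full_cycle sigma -> c ^+ d = 1 ->
  exists2 z : 'I_d -> R, forall p, z p = c * z (sigma p) & z j0 = 1.
Proof.
case: d sigma j0 => [|d] sigma j0; first by case: j0.
move=> sP cd; have card_orb j : #|porbit sigma j| = d.+1.
  by rewrite (full_cycleP sP) cardsT card_ord.
exists (fun j => \sum_(a < d.+1) (iter a sigma j == j0)%:R * c ^+ a).
  move=> j; rewrite mulr_sumr.
  have -> : \sum_(a < d.+1) c * ((iter a sigma (sigma j) == j0)%:R * c ^+ a) =
      \sum_(a < d.+1) (iter a.+1 sigma j == j0)%:R * c ^+ a.+1.
    by apply: eq_bigr => a _; rewrite mulrCA -exprS iterSr.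
  pose f a := (iter a sigma j == j0)%:R * c ^+ a.
  have := erefl (\sum_(a < d.+2) f a).
  rewrite [LHS]big_ord_recr [RHS]big_ord_recl /= /f /= cd expr0.
  have := iter_porbit sigma j; rewrite card_orb /= => ->.
  by rewrite addrC => /addrI.
have := uniq_traject_porbit sigma j0; rewrite card_orb /= => /andP[j0N _].
rewrite big_ord_recl eqxx expr0 mulr1 big1 ?addr0 // => a _.
case: eqP => [aj0|_]; last by rewrite mul0r.
case/negP: j0N; apply/trajectP; exists a => //.
by rewrite -iterSr -[LHS]aj0.
Qed.

Lemma natr_dvd_fact_neq0 (d m : nat) (K : fieldType) :
    (forall p, p \in [pchar K] -> ~~ (p %| d`!)%N) -> (m %| d`!)%N ->
  m%:R != 0 :> K.
Proof.
move=> hchar md; have m0 : (0 < m)%N by apply: dvdn_gt0 md; apply: fact_gt0.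
apply/negP => m0K; have [p pK] := natf0_pchar m0 m0K.
case/negP: (hchar p pK); apply: dvdn_trans md.
by rewrite (dvdn_pcharf pK).
Qed.

(** Over [K[t]/(t^N)] the zero of the model lifts, so the polynomial
    [Det (M + t (A - M))] is divisible by [t ^ N]; for [N] large it is zero. *)
Lemma heval_cyclic_eq0 (d n : nat) (K : fieldType) (D : hyperpoly d n.+1)
    (sigma : 'S_d) (c : K) (A : hypermatrix d n.+1 K) :
    (3 <= d)%N -> (d`!)%:R != 0 :> K -> (d - 2)%:R != 0 :> K ->
    is_hyperdeterminant D -> is_full_cycle sigma -> c ^+ d = 1 -> c != 1 ->
    (forall j k I, \sum_(g : 'S_d | g j == k) A [ffun l => I (g l)] =
       c * \sum_(g : 'S_d | g (sigma j) == k) A [ffun l => I (g l)]) ->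
  heval D A = 0.
Proof.
move=> hd factK d2K Ddet sigmaP cd c_neq1 Afib.
have d_gt0 : (0 < d)%N by apply: leq_trans hd.
have d_gt1 : (1 < d)%N by apply: ltnW.
have c1 : 1 - c != 0 by rewrite subr_eq0 eq_sym.
have cc' : c ^+ d.-1 * c = 1 by rewrite -exprSr prednK.
pose j0 := Ordinal d_gt0.
have [z zc zj0] := cyclic_weights j0 sigmaP cd.
pose A0 := model_hm n z; pose B := path_hm A (-1) A0.
pose At := path_hm (map_hm polyC A0) 'X (map_hm polyC B).
pose P := heval D At.
have -> : heval D A = P.[1].
  rewrite -[RHS]/(horner_eval 1 P) -heval_map.
  congr heval; apply/ffunP => I.
  rewrite [RHS]ffunE [At I]ffunE ![map_hm polyC _ _]ffunE /= /horner_eval.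
  rewrite !hornerE [B I]ffunE.
  by rewrite mulN1r addrC subrK.
suff -> : P = 0 by rewrite horner0.
(* With this N the remainder of P modulo 'X^N is P. *)
pose N := (size P).+1; pose h : {poly K} := 'X^N.
suff : in_qpoly h P = 0.
  move/(congr1 val) => /=; rewrite mk_monic_Xn.
  by rewrite Pdiv.CommonRing.rmodp_small // size_polyXn.
pose f : {rmorphism K -> {poly %/ h}} := in_qpoly h \o polyC.
rewrite -heval_map map_path_hm.
have -> : map_hm (in_qpoly h) (map_hm polyC A0) = model_hm n (fun p => f (z p)).
  by rewrite -map_model; apply/ffunP => I; rewrite !ffunE.
have -> : map_hm (in_qpoly h) (map_hm polyC B) =
    path_hm (map_hm f A) (-1) (model_hm n (fun p => f (z p))).
  rewrite -map_model -(rmorphN1 f) -map_path_hm.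
  by apply/ffunP => I; rewrite !ffunE.
apply: (heval_path d_gt0 Ddet sigmaP (c := f c) (c' := f (c ^+ d.-1))
  (e := f (1 - c)^-1) _ _ (j0 := j0) (k' := f (d - 2)%:R^-1) (N := N)) => //.
- by rewrite -rmorphM cc' rmorph1.
- by rewrite -{1}(rmorph1 f) -rmorphB -rmorphM mulVf ?rmorph1.
- rewrite -rmorphXn; apply: val_inj => /=; rewrite mk_monic_Xn.
  by rewrite Pdiv.RingMonic.rmodpp ?monicXn.
- by rewrite zj0 rmorph1 mulr1 -(rmorph_nat f) -rmorphM mulfV ?rmorph1.
- by move=> p; rewrite -rmorphM -zc.
apply: (cyclic_covariant_fibre (e := f (d`!)%:R^-1)) => [|j k I].
  by rewrite -(rmorph_nat f) -rmorphM mulVf ?rmorph1.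
have map_sum (Q : pred 'S_d) :
    \sum_(g | Q g) map_hm f A [ffun l => I (g l)] =
    f (\sum_(g | Q g) A [ffun l => I (g l)]).
  by rewrite rmorph_sum; apply: eq_bigr => g _; rewrite ffunE.
by rewrite !map_sum Afib rmorphM.
Qed.

Theorem theorem3p8 (d : nat) (K : fieldType) (omega : K) (V : vectType K)
    (sigma : 'S_d) (i : nat) (F : formfun d V)
    (n : nat) (b : n.-tuple V) (Det : hyperpoly d n)
    (hd : (3 <= d)%N)
    (hchar : forall p : nat, p \in [pchar K] -> ~~ (p %| d`!)%N)
    (homega : d.-primitive_root omega)
    (hV : (0 < \dim {:V})%N)
    (hsigma : is_full_cycle sigma)
    (hi : (1 <= i <= d.-1)%N)
    (hmul : multilinear F)
    (hF : sum_of_subspaces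
      (fun U : formfun d V -> Prop =>
         (exists lam : seq nat,
            [/\ is_partition d lam, lam <> [:: d], lam <> [:: d.-1; 1%N]
              & U = isotypic lam])
         \/ U = std_eigen sigma omega i) F)
    (hb : basis_of {:V} b)
    (hDet : is_hyperdeterminant Det) :
  hyperpoly_eval Det (hypermatrix_of_form b F) = 0.
Proof.
have natK m : (0 < m <= d)%N -> m%:R != 0 :> K.
  by move=> ?; apply: natr_dvd_fact_neq0 hchar _; apply: dvdn_fact.
have factK : (d`!)%:R != 0 :> K by apply: natr_dvd_fact_neq0 hchar _.
have n_gt0 : (0 < n)%N by rewrite -(vector.size_basis hb).
case: n n_gt0 b Det hb hDet => // n _ b Det hb hDet.
have d_gt0 : (0 < d)%N by apply: leq_trans hd.
have /andP[i_gt0 ltid] : (0 < i < d)%N.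
  by case/andP: hi => -> le_i_d; rewrite -(prednK d_gt0) ltnS.
apply: (heval_cyclic_eq0 (c := omega ^+ i) hd factK _ hDet hsigma).
- by apply: natK; rewrite subn_gt0 hd leq_subr.
- by rewrite exprAC (prim_expr_order homega) expr1n.
- by rewrite -(prim_order_dvd homega) gtnNdvd.
move=> j k I; set A := hypermatrix_of_form b F.
have AE (P : pred 'S_d) : \sum_(g | P g) A [ffun l => I (g l)] =
    \sum_(g | P g) perm_form g F [ffun l => tnth b (I l)].
  apply: eq_bigr => g _; rewrite ffunE /perm_form; congr F.
  by apply/ffunP => l; rewrite !ffunE.
rewrite !AE; apply: fibre_sum_covariant hF j k _.
by apply: natK; apply: ltnW hd.
Qed.
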